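(* Let $d\ge2$, $\alpha=\frac{d+\sqrt{d^2+4}}{2}$, $\beta=\frac{d-\sqrt{d^2+4}}{2}$, and let $k\ge1$. The number of Deedees in block $k$ equals the number of positive integers $n$ with $\lfloor\log_\alpha(n)\rfloor+1=k$. The number of Edees in block $k$ equals the number of $n\in J$ with $\lfloor\log_\alpha(n(\alpha-\beta))\rfloor+1=k$, where $J$ is the set of positive integers if $d$ is odd and the set of positive half-integers $\{\tfrac12,1,\tfrac32,2,\dots\}$ if $d$ is even.
   Context: Define $(D_n)_{n\in\mathbb Z}$ by $D_0=0$, $D_1=1$, $D_{n+1}=dD_n+D_{n-1}$, and $(E_n)_{n\in\mathbb Z}$ by $E_0=2$, $E_1=d$, $E_{n+1}=dE_n+E_{n-1}$ (companion numbers). An Ostrowski word is a finite word $d_1\cdots d_i$ over $\{0,\dots,d\}$ with $0\le d_1<d$, $0\le d_j\le d$ for $j>1$, and $d_{j-1}=0$ whenever $d_j=d$; it represents $\sum_j d_jD_j$. Every non-negative integer has a unique Ostrowski word with nonzero last digit. An Ostrowski word is trimmed if its last digit is nonzero and it cannot be written as $0v$ with $v$ an Ostrowski word (equivalently, its first digit is nonzero, or its first two digits are $0$ and $d$). Let $w_1,w_2,\dots$ be the trimmed Ostrowski words listed in increasing order of the integers they represent, and $|w_m|$ the length of $w_m$. For $m,n\ge1$ let $A_{m,n}$ be the integer represented by $0^{n-1}w_m$; rows satisfy $A_{m,n+1}=dA_{m,n}+A_{m,n-1}$ and are extended to all $n\in\mathbb Z$ by this recurrence. Block $k$ consists of the rows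 $m$ with $|w_m|\in\{2k-1,2k\}$. A row $m$ is a Deedee if there are a positive integer $j$ and $s\in\mathbb Z$ with $A_{m,n}=jD_{n+s}$ for all $n\in\mathbb Z$; it is an Edee if there are $j\in J$ and $s\in\mathbb Z$ with $A_{m,n}=jE_{n+s}$ for all $n\in\mathbb Z$. *)

(* Defs.v *)
From HB Require Import structures.
From mathcomp Require Import all_boot all_order all_algebra.
From mathcomp Require Import ring lra zify.
From mathcomp Require Import boolp classical_sets functions cardinality.
From mathcomp Require Import reals exp.

Set Implicit Arguments.
Unset Strict Implicit.
Unset Printing Implicit Defensive.

Import Order.TTheory GRing.Theory Num.Theory.

Local Open Scope classical_set_scope.
Local Open Scope card_scope.
Local Open Scope ring_scope.

(* The two-sided solution of x (n + 1) = d * x n + x (n - 1) with x 0 = a and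
   x 1 = b: iterate (x i, x (i+1)) |-> (x (i+1), x (i+2)) or its inverse. *)
Definition two_sided (d : nat) (a b : int) (n : int) : int :=
  match n with
  | Posz k => (iter k (fun p => (p.2, d%:Z * p.2 + p.1)) (a, b)).1
  | Negz k => (iter k.+1 (fun p => (p.2 - d%:Z * p.1, p.1)) (a, b)).1
  end.

Definition D (d : nat) : int -> int := two_sided d 0 1.
Definition E (d : nat) : int -> int := two_sided d 2 d%:Z.

Arguments D : simpl never.
Arguments E : simpl never.

(* A word d_1 ... d_i is the list [:: d_1; ...; d_i], least significant digit
   first. *)
Definition ostrowski (d : nat) (u : seq nat) : bool :=
  [&& (head 0 u < d)%N, all (fun x => (x <= d)%N) u &
      sorted (fun x y => (y == d) ==> (x == 0)%N) u].

Definition value (d : nat) (u : seq nat) : int :=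
  \sum_(j < size u) (nth 0%N u j)%:Z * D d j.+1%:Z.

(* The empty word is excluded, because last 0 [::] = 0. *)
Definition trimmed (d : nat) (u : seq nat) : Prop :=
  [/\ ostrowski d u, last 0%N u != 0%N &
      forall v, ostrowski d v -> u <> 0%N :: v].

(* The listing is w 1, w 2, ...; w 0 is irrelevant. *)
Definition trimmed_listing (d : nat) (w : nat -> seq nat) : Prop :=
  [/\ forall m, (0 < m)%N -> trimmed d (w m),
      forall u, trimmed d u -> exists2 m, (0 < m)%N & w m = u &
      forall m n, (0 < m)%N -> (m < n)%N -> value d (w m) < value d (w n)].

(* The row of the word u: its n-th entry is the value of 0^(n-1) u for n >= 1,
   and the recurrence gives the entries with n <= 0. *)
Definition row (d : nat) (u : seq nat) (n : int) : int :=
  if 1 <= n then value d (nseq `|n - 1|%N 0%N ++ u)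
  else two_sided d (value d u) (value d (0%N :: u)) (n - 1).

Definition in_block (k : nat) (u : seq nat) : bool :=
  (size u == 2 * k - 1)%N || (size u == 2 * k)%N.

Definition J (d : nat) : set rat :=
  [set q | exists2 n : nat, (0 < n)%N & q = if odd d then n%:R else n%:R / 2].

Definition deedee (d : nat) (u : seq nat) : Prop :=
  exists (j : nat) (s : int), (0 < j)%N /\
    forall n : int, row d u n = j%:Z * D d (n + s).

Definition edee (d : nat) (u : seq nat) : Prop :=
  exists (j : rat) (s : int), J d j /\
    forall n : int, (row d u n)%:~R = j * (E d (n + s))%:~R.

Definition alpha (R : realType) (d : nat) : R :=
  (d%:R + Num.sqrt (d%:R ^+ 2 + 4)) / 2.
Definition beta (R : realType) (d : nat) : R :=
  (d%:R - Num.sqrt (d%:R ^+ 2 + 4)) / 2.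

Definition logb (R : realType) (b x : R) : R := ln x / ln b.

Lemma two_sided0 d a b : two_sided d a b 0 = a.
Proof. by []. Qed.

Lemma two_sided1 d a b : two_sided d a b 1 = b.
Proof. by []. Qed.

Lemma two_sided_rec d a b (n : int) :
  two_sided d a b (n + 1) = d%:Z * two_sided d a b n + two_sided d a b (n - 1).
Proof.
case: n => [[|k]|k].
- by rewrite add0r /=; ring.
- have -> : Posz k.+1 + 1 = Posz k.+2 by lia.
  by have -> : Posz k.+1 - 1 = Posz k by lia.
- have -> : Negz k - 1 = Negz k.+1 by lia.
  case: k => [|k].
    by have -> : Negz 0 + 1 = 0 by []; rewrite /=; ring.
  have -> : Negz k.+1 + 1 = Negz k by lia.
  by rewrite /=; ring.
Qed.

Lemma value_cat0 d u (i : nat) :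
  value d (nseq i 0%N ++ u) =
  \sum_(j < size u) (nth 0%N u j)%:Z * D d (j.+1 + i)%:Z.
Proof.
rewrite /value size_cat size_nseq big_split_ord /= big1 ?add0r => [|j _].
  apply: eq_bigr => j _; rewrite nth_cat size_nseq ltnNge leq_addr /= addKn.
  by congr (_ * D d (Posz _)); lia.
by rewrite nth_cat size_nseq ltn_ord nth_nseq ltn_ord mul0r.
Qed.

Lemma row_rec d u (n : int) :
  row d u (n + 1) = d%:Z * row d u n + row d u (n - 1).
Proof.
suff rowE m : row d u m = two_sided d (value d u) (value d (0%N :: u)) (m - 1).
  rewrite !rowE -two_sided_rec; congr (two_sided _ _ _ _); ring.
rewrite /row; case: ifP => // m1.
have -> : m - 1 = `|m - 1|%N :> int by lia.
rewrite absz_nat; move: `|m - 1|%N => i {m m1}.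
elim/ltn_ind: i => -[|[|i]] IH //.
have -> : two_sided d (value d u) (value d (0%N :: u)) i.+2 =
    two_sided d (value d u) (value d (0%N :: u)) (i.+1%:Z + 1).
  by congr two_sided; lia.
rewrite two_sided_rec; have -> : i.+1%:Z - 1 = i by lia.
rewrite -!IH // !value_cat0 mulr_sumr -big_split; apply: eq_bigr => j _ /=.
have -> : (j.+1 + i.+2)%:Z = (j.+1 + i.+1)%:Z + 1 by lia.
rewrite /D two_sided_rec.
have -> : (j.+1 + i.+1)%:Z - 1 = (j.+1 + i)%:Z by lia.
ring.
Qed.

Section ListingExists.
Variable d : nat.
Hypothesis hd : (2 <= d)%N.

Lemma D_rec (i : nat) : D d i.+2%:Z = d%:Z * D d i.+1%:Z + D d i%:Z.
Proof. by []. Qed.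

Lemma D_gt0 (i : nat) : 0 < D d i.+1%:Z.
Proof.
elim/ltn_ind: i => -[|[|i]] IH //; rewrite D_rec.
  by rewrite /D /=; nia.
have := IH i (ltnW (ltnSn _)); have := IH i.+1 (ltnSn _); nia.
Qed.

Lemma D_ge0 (i : nat) : 0 <= D d i%:Z.
Proof. by case: i => // i; apply/ltW/D_gt0. Qed.

Lemma value_rcons u x :
  value d (rcons u x) = value d u + x%:Z * D d (size u).+1%:Z.
Proof.
rewrite /value size_rcons big_ord_recr /= nth_rcons ltnn eqxx; congr (_ + _).
by apply: eq_bigr => j _; rewrite nth_rcons ltn_ord.
Qed.

Lemma ostrowski_rcons u x : ostrowski d (rcons u x) =
  [&& ostrowski d u, (x <= d)%N, (u == [::]) ==> (x < d)%N
    & (x == d) ==> (last 0 u == 0)%N].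
Proof.
rewrite /ostrowski all_rcons; case: u => [|y u] /=.
  rewrite andbT; case: ltngtP => //= *; lia.
rewrite rcons_path; case: (y < d)%N => //=; case: (x <= d)%N => //=.
  by rewrite !andbA.
by rewrite !andbF.
Qed.

Lemma value_bounds u : ostrowski d u -> 0 <= value d u < D d (size u).+1%:Z.
Proof.
have [n] := ubnP (size u); elim: n u => // n IH u.
case/lastP: u => [|u x]; first by rewrite /value big_ord0.
rewrite size_rcons ltnS ostrowski_rcons => su /and4P[ou xd ux0 xl].
have := IH _ su ou; rewrite value_rcons D_rec; have := D_gt0 (size u).
case: (eqVneq x d) xl ux0 => [-> /= ul|xnd _ _]; last first.
  by have := D_ge0 (size u); nia.
case/lastP: u ul ou su => [|u y]; first by rewrite ltnn.
rewrite last_rcons => /eqP ->; rewrite ostrowski_rcons => /and4P[ou _ _ _].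
rewrite size_rcons => su D0 _; have := IH _ (ltnW su) ou.
rewrite value_rcons mul0r addr0; nia.
Qed.

Lemma value_inj u v : size u = size v -> ostrowski d u -> ostrowski d v ->
  value d u = value d v -> u = v.
Proof.
elim/last_ind: u v => [|u x IH] v; first by move=> /esym/size0nil ->.
case/lastP: v => [|v y]; first by rewrite size_rcons.
rewrite !size_rcons => -[] s; rewrite !ostrowski_rcons !value_rcons s.
move=> /andP[ou _] /andP[ov _] e.
have := value_bounds ou; have := value_bounds ov; rewrite s => vb ub.
have xy : x = y by nia.
by rewrite xy (IH v) //; move: e; rewrite xy => /addIr.
Qed.

Lemma value_ge u : ostrowski d u -> last 0%N u != 0%N ->
  D d (size u)%:Z <= value d u.
Proof.
case/lastP: u => // u x; rewrite last_rcons ostrowski_rcons value_rcons.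
rewrite size_rcons => /andP[/value_bounds + _] x0; have := D_gt0 (size u); nia.
Qed.

Lemma D_le (i j : nat) : (i <= j)%N -> D d i%:Z <= D d j%:Z.
Proof.
elim: j => [|j IH]; first by rewrite leqn0 => /eqP ->.
rewrite leq_eqVlt => /predU1P[-> //|/IH ij]; apply: le_trans ij _.
case: j {IH} => [|[|j]] //; first by rewrite D_rec /D /=; nia.
by rewrite [D d j.+3%:Z]D_rec; have := D_gt0 j; have := D_gt0 j.+1; nia.
Qed.

Lemma trimmed_value_inj u v : trimmed d u -> trimmed d v ->
  value d u = value d v -> u = v.
Proof.
suff H a b : trimmed d a -> trimmed d b -> value d a = value d b ->
    (size a <= size b)%N.
  move=> tu tv e; have [[ou _ _] [ov _ _]] := (tu, tv).
  by apply: value_inj (e) => //; apply/eqP; rewrite eqn_leq !H.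
move=> [oa la _] [ob lb _] e; rewrite leqNgt; apply/negP => /D_le.
by have := value_ge oa la; have /andP[_] := value_bounds ob; rewrite e; lia.
Qed.

Lemma trimmed_unbounded (N : nat) :
  exists2 u, trimmed d u & N%:Z <= value d u.
Proof.
exists (1%N :: rcons (nseq N 0%N) 1%N); last first.
  have -> : value d (1%N :: rcons (nseq N 0%N) 1%N) = 1 + D d N.+2%:Z.
    rewrite -rcons_cons value_rcons /= size_nseq mul1r; congr (_ + _).
    rewrite /value /= big_ord_recl big1 => [|j _]; first by rewrite addr0.
    by rewrite /= nth_nseq if_same mul0r.
  elim: N => [|N IH]; first by have := D_gt0 1; lia.
  by rewrite D_rec; have := D_gt0 N; have := D_gt0 N.+1; nia.
split=> //; first last.
  by rewrite -rcons_cons last_rcons.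
have : ostrowski d (1%N :: nseq N 0%N).
  elim: N => [|N IH]; first by rewrite /ostrowski /= !andbT; lia.
  have <- : rcons (nseq N 0%N) 0%N = nseq N.+1 0%N.
    by elim: (N) => //= n ->.
  rewrite -rcons_cons ostrowski_rcons IH /=; lia.
rewrite -rcons_cons ostrowski_rcons => -> /=; lia.
Qed.

Lemma trimmed_listing_exists : exists w, trimmed_listing d w.
Proof.
pose P (N : nat) := `[< exists2 u, trimmed d u & value d u = N%:Z >].
have vE u : trimmed d u -> value d u = `|value d u|%N%:Z.
  by case=> /value_bounds /andP[u0 _] _ _; lia.
have ex N : exists M, (N <= M)%N && P M.
  have [u tu uN] := trimmed_unbounded N; exists `|value d u|%N.
  by apply/andP; split; [lia | apply/asboolP; exists u => //; exact: vE].
pose next N := ex_minn (ex N).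
have nextP N : [/\ (N <= next N)%N, P (next N) &
    forall M, (N <= M)%N -> P M -> (next N <= M)%N].
  rewrite /next; case: ex_minnP => M /andP[NM PM] mM; split=> // K NK PK.
  by apply: mM; rewrite NK.
pose f m := iter m (fun N => next N.+1) (next 0).
have fP m : P (f m) 
  by case: m => [|m] /=; [have [] := nextP 0%N | have [] := nextP (f m).+1].
have fS m : (f m < f m.+1)%N by have [] := nextP (f m).+1.
have fm m n : (m < n)%N -> (f m < f n)%N.
  elim: n => // n IH; rewrite ltnS leq_eqVlt => /predU1P[->|/IH fmn] //.
  exact: ltn_trans fmn (fS n).
have fge m : (m <= f m)%N by elim: m => // m IH; apply: leq_ltn_trans (fS m).
have fsurj N : P N -> exists m, f m = N.
  move=> PN; have ex' : exists m, (N <= f m)%N by exists N.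
  case: (ex_minnP ex') => m Nm mm; exists m; apply/eqP; rewrite eqn_leq Nm andbT.
  case: m Nm mm => [|m] Nm mm; first by have [_ _] := nextP 0%N; apply.
  have [_ _] := nextP (f m).+1; apply=> //; rewrite ltnNge.
  by apply/negP => /mm; rewrite ltnn.
have /choice[g gP] m : exists u, trimmed d u /\ value d u = (f m)%:Z.
  by have /asboolP[u] := fP m; exists u.
exists (fun m => g m.-1); split=> [m _|u tu|[|m] [|n] //= _ mn].
- by case: (gP m.-1).
- have [|m fmE] := fsurj `|value d u|%N.
    by apply/asboolP; exists u => //; exact: vE.
  exists m.+1 => //=; have [tg vg] := gP m; apply: trimmed_value_inj => //.
  by rewrite vg fmE -vE.
- by have [_ ->] := gP m; have [_ ->] := gP n; rewrite ltz_nat fm.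
Qed.

End ListingExists.

(* Main.v *)
(* For a word u of length L put A(u) = sum_j u_j alpha^(j-1) and
   B(u) = sum_j u_j beta^(j-1); the n-th entry of the row of u is
   (A(u) alpha^n - B(u) beta^n) / (alpha - beta).  If u is trimmed, then
   alpha^(L-1) <= A(u) < alpha^L and 1/alpha < |B(u)| < alpha.  A row that is
   the shift by s of a sequence x with
   N := x_1 - beta x_0 = |x_1 - alpha x_0| > 0 has A(u) = alpha^s N and
   |B(u)| = alpha^(-s) N, so L - 1 <= 2 s <= L and the floor of log_alpha N is
   L - s - 1, which is k - 1 exactly when L is 2k - 1 or 2k.  Here N = j for
   j D and N = j (alpha - beta) for j E.  Conversely every such x is, up to a
   shift, exactly one row: for large n the Ostrowski word v of x_n has
   value(0v) = x_(n+1), because both numbers lie close to alpha x_n.  Hence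
   j |-> (its row) is a bijection between parameters and rows. *)

Require Import Defs.
From mathcomp Require Import all_boot all_order all_algebra.
From mathcomp Require Import ring lra zify.
From mathcomp Require Import boolp classical_sets functions cardinality.
From mathcomp Require Import reals exp.

Set Implicit Arguments.
Unset Strict Implicit.
Unset Printing Implicit Defensive.

Import Order.TTheory GRing.Theory Num.Theory.

Local Open Scope classical_set_scope.
Local Open Scope card_scope.
Local Open Scope ring_scope.

(** * Two-sided recurrences and the rows of words *)

Definition recurrent (d : nat) (x : int -> int) : Prop :=
  forall n, x (n + 1) = d%:Z * x n + x (n - 1).

(** The coefficient of x (n - 1) is 1, so two adjacent values determine the sequence in both
    directions. *)
Lemma recurrent_unique d x y m : recurrent d x -> recurrent d y ->
  x m = y m -> x (m + 1) = y (m + 1) -> x =1 y.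
Proof.
move=> rx ry e0 e1.
have H (n : int) : x (m + n) = y (m + n) /\ x (m + n + 1) = y (m + n + 1).
  elim/int_ind: n => [|n [IH0 IH1]|n [IH0 IH1]]; first by rewrite addr0.
    have -> : m + n.+1%:Z = m + n + 1 by lia.
    split=> //; rewrite rx ry IH1; congr (_ + _).
    by rewrite addrK IH0.
  have -> : m + - n.+1%:Z = m - n%:Z - 1 by lia.
  rewrite subrK; split=> //.
  by have := rx (m - n%:Z); rewrite IH1 IH0 ry => /addrI.
by move=> n; have [] := H (n - m); rewrite addrCA subrr addr0.
Qed.

Lemma recurrent_shift d x s : recurrent d x -> recurrent d (fun n => x (n + s)).
Proof. by move=> rx n; rewrite addrAC rx addrAC. Qed.

Lemma row_shift d u n : Defs.row d (0%N :: u) n = Defs.row d u (n + 1).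
Proof.
move: n; apply: (@recurrent_unique d _ _ 1) => //; first exact: row_rec.
exact/(@recurrent_shift d)/row_rec.
Qed.

Lemma row_shiftn d u i n :
  Defs.row d (nseq i 0%N ++ u) n = Defs.row d u (n + i%:Z).
Proof.
elim: i n => [|i IH] n; first by rewrite addr0.
by rewrite /= row_shift IH; congr Defs.row; lia.
Qed.

(** * Ostrowski words: uniqueness, existence and trimming *)

Lemma ostrowski_cat0 d u i : (2 <= d)%N -> ostrowski d u ->
  ostrowski d (nseq i 0%N ++ u).
Proof.
move=> hd ou; elim: i => //= i; rewrite /ostrowski /=.
case: (nseq i 0%N ++ u) => [|x v] /=; first by rewrite !andbT; lia.
by move=> /and3P[_ -> ->]; rewrite implybT /= !andbT; lia.
Qed.

Lemma last_cat0 u i : last 0%N (nseq i 0%N ++ u) = last 0%N u.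
Proof. by elim: i => //= i; case: (nseq i 0%N ++ u). Qed.

(** A word u of length L with nonzero last digit satisfies D_L <= value u < D_(L+1), so the value
    determines the length; words of equal length are separated by [value_inj]. *)
Lemma ostrowski_value_inj d u v : (2 <= d)%N ->
  ostrowski d u -> ostrowski d v ->
  last 0%N u != 0%N -> last 0%N v != 0%N -> value d u = value d v -> u = v.
Proof.
move=> hd; suff H a b : ostrowski d a -> ostrowski d b -> last 0%N a != 0%N ->
    value d a = value d b -> (size a <= size b)%N.
  by move=> ou ov lu lv e; apply: (value_inj hd _ ou ov e); apply/eqP;
    rewrite eqn_leq !H.
move=> oa ob la e; rewrite leqNgt; apply/negP => /(D_le hd).
by have := value_ge hd oa la; have /andP[_] := value_bounds hd ob; rewrite e; lia.
Qed.

(** Greedy expansion: the last digit is the quotient of x by the largest available D, and the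
    remainder is expanded in turn. *)
Lemma ostrowski_exists d (hd : (2 <= d)%N) L (x : int) :
  0 <= x < D d L.+1%:Z ->
  exists u, [/\ ostrowski d u, size u = L & value d u = x].
Proof.
elim/ltn_ind: L x => -[|L] IH x /andP[x0 xD].
  exists [::]; split=> //; first by rewrite /ostrowski /=; lia.
  by move: xD; rewrite /value big_ord0 /D /=; lia.
have D0 := D_gt0 hd L; rewrite D_rec in xD.
have [q [r [xE rb]]] : exists q r, x = q * D d L.+1%:Z + r /\ 0 <= r < D d L.+1%:Z.
  exists (x %/ D d L.+1%:Z)%Z, (x %% D d L.+1%:Z)%Z; split; first exact: divz_eq.
  by rewrite ltz_pmod // modz_ge0 //; lia.
have q0 : 0 <= q by nia.
have DL : D d L%:Z <= D d L.+1%:Z by apply: D_le.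
have qd : q <= d%:Z.
  rewrite -ltzD1 -(ltr_pM2r D0); lia.
have [qd'|qd'] := ltrP q d%:Z.
  have [u [ou su vu]] := IH L (ltnSn _) _ rb.
  exists (rcons u `|q|%N); split.
  - by rewrite ostrowski_rcons // ou; apply/and3P; split; lia.
  - by rewrite size_rcons su.
  - by rewrite value_rcons vu su; lia.
have qE : q = d%:Z by lia.
(* A quotient d leaves a remainder small enough for a word two digits shorter, so the digit before d
   can be 0. In length 1 it cannot occur, since x < D_2 = d. *)
case: L IH D0 xD rb xE {q0 qd qd'} DL => [|L] IH D0 xD rb xE DL.
  by move: xD xE rb; rewrite /D /= qE; lia.
have [|u [ou su vu]] := IH L (ltnW (ltnSn _)) r; first lia.
exists (rcons (rcons u 0%N) d); split.
- rewrite !ostrowski_rcons // ou last_rcons eqxx implybT leqnn /=.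
  have -> : (0%N == d) = false by lia.
  have -> : (0 < d)%N by lia.
  by rewrite implybT; case: (u).
- by rewrite !size_rcons su.
- by rewrite !value_rcons size_rcons vu su mul0r addr0; lia.
Qed.

(** Length |x| suffices because n < D_(n+1); zeros at the end are then dropped. *)
Lemma ostrowski_pos_exists d (hd : (2 <= d)%N) (x : int) : 0 < x ->
  exists u, [/\ ostrowski d u, last 0%N u != 0%N & value d u = x].
Proof.
move=> x0; have [u [ou _ vu]] : exists u,
    [/\ ostrowski d u, size u = `|x|%N & value d u = x].
  apply: ostrowski_exists => //; rewrite (ltW x0) /=.
  suff : `|x|%N%:Z < D d `|x|.+1%:Z by lia.
  elim: (`|x|%N) => // n IH; rewrite D_rec.
  by have := D_gt0 hd n; have := D_ge0 hd n; nia.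
elim/last_ind: u ou vu => [|u y IH]; first by rewrite /value big_ord0; lia.
have [->|y0] := eqVneq y 0%N; last by exists (rcons u y); rewrite last_rcons.
by rewrite ostrowski_rcons // value_rcons mul0r addr0 => /andP[ou _] /(IH ou).
Qed.

(** Leading zeros are removed for as long as the rest is an Ostrowski word. *)
Lemma trimmed_of_ostrowski d u : ostrowski d u -> last 0%N u != 0%N ->
  exists v i, trimmed d v /\ u = nseq i 0%N ++ v.
Proof.
elim: u => // x u IH ou lu.
have [[/eqP x0 ou']|H] := pselect (x == 0%N /\ ostrowski d u).
  have [|v [i [tv ->]]] := IH ou'; first by case: (u) lu => //=; rewrite x0.
  by exists v, i.+1; rewrite x0.
exists (x :: u), 0%N; split=> //; split=> // v ov [x0 uv].
by apply: H; rewrite x0 uv.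
Qed.

(** If s <= t, uniqueness of Ostrowski words gives v = 0^(t-s) u, and v being trimmed forces t =
    s. *)
Lemma trimmed_shift_unique d u v x s t : (2 <= d)%N ->
  trimmed d u -> trimmed d v ->
  (forall n, Defs.row d u n = x (n + s)) ->
  (forall n, Defs.row d v n = x (n + t)) -> u = v.
Proof.
move=> hd; wlog st : u v s t / s <= t.
  move=> H tu tv xu xv; have [st|/ltW ts] := leP s t; first exact: (H _ _ s t).
  by symmetry; apply: (H _ _ t s).
move=> [ou lu _] [ov lv trv] xu xv.
pose i := `|t - s|%N.
have vE : v = nseq i 0%N ++ u.
  apply: (@ostrowski_value_inj d) => //; rewrite ?last_cat0 //.
    exact: ostrowski_cat0.
  have : Defs.row d v 1 = Defs.row d u (1 + i%:Z).
    by rewrite xv xu; congr x; lia.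
  by rewrite -row_shiftn.
by case: i vE => // i vE; have := trv _ (ostrowski_cat0 i hd ou) vE.
Qed.

(** * Evaluation of words at the roots of t^2 - d t - 1 *)

Section Digits.
Variable K : fieldType.

(** At alpha and beta these are the numbers A(u) and B(u). *)
Definition digit_eval (c : K) (u : seq nat) : K :=
  \sum_(j < size u) (nth 0%N u j)%:R * c ^+ j.

Lemma digit_eval_cons c x u :
  digit_eval c (x :: u) = x%:R + c * digit_eval c u.
Proof.
rewrite /digit_eval big_ord_recl expr0 mulr1 mulr_sumr; congr (_ + _).
by apply: eq_bigr => j _; rewrite exprS; ring.
Qed.

Lemma digit_eval_rcons c u x :
  digit_eval c (rcons u x) = digit_eval c u + x%:R * c ^+ size u.
Proof.
rewrite /digit_eval size_rcons big_ord_recr /= nth_rcons ltnn eqxx.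
by congr (_ + _); apply: eq_bigr => j _; rewrite nth_rcons ltn_ord.
Qed.

(** Since a and b are the roots of t^2 - d t - 1, the sequence x_(n+1) - b x_n is geometric with
    ratio a. The hypotheses are symmetric, so the roots may be swapped. *)
Lemma recurrent_geom d (x : int -> int) (a b : K) (m n : int) :
  a + b = d%:R -> a * b = -1 -> recurrent d x ->
  (x (m + n + 1))%:~R - b * (x (m + n))%:~R =
  a ^ n * ((x (m + 1))%:~R - b * (x m)%:~R).
Proof.
move=> abD abM rx.
have a0 : a != 0.
  apply/eqP => a0; move: abM; rewrite a0 mul0r => /eqP.
  by rewrite eq_sym oppr_eq0 oner_eq0.
have step (i : int) : (x (i + 1))%:~R - b * (x i)%:~R =
    a * ((x i)%:~R - b * (x (i - 1))%:~R).
  rewrite rx rmorphD rmorphM /= -pmulrn -abD mulrBr mulrA abM.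
  move: (x i)%:~R (x (i - 1))%:~R => u v; ring.
elim/int_ind: n => [|n IH|n IH].
- by rewrite expr0z mul1r addr0.
- rewrite step; have -> : m + n.+1%:Z - 1 = m + n by lia.
  have -> : m + n.+1%:Z = m + n + 1 by lia.
  by rewrite IH exprSz mulrA.
- have -> : m + - n.+1%:Z = m - n%:Z - 1 by lia.
  rewrite subrK; apply: (mulfI a0); rewrite -step IH mulrA.
  congr (_ * _); rewrite -[in RHS](expr1z a) -expfzDr ?expr1z //.
  by congr (_ ^ _); lia.
Qed.

(** Summing D_(j+1) - b D_j = a^j over the digits of u. *)
Lemma row_geom d u (a b : K) : a + b = d%:R -> a * b = -1 ->
  (Defs.row d u 2)%:~R - b * (Defs.row d u 1)%:~R = a * digit_eval a u.
Proof.
move=> abD abM; rewrite /Defs.row /= -(cat1s 0%N) -[[:: 0%N]]/(nseq 1 0%N).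
rewrite value_cat0 /value !rmorph_sum /= /digit_eval !mulr_sumr -sumrB.
apply: eq_bigr => j _; rewrite !rmorphM /= -!pmulrn.
have rD : recurrent d (D d) by exact: two_sided_rec.
have := @recurrent_geom d (D d) a b 0 (j.+1)%:Z abD abM rD.
have -> : (j.+1 + 1)%:Z = 0 + j.+1%:Z + 1 by lia.
have -> : D d (0 + 1) = 1 by [].
have -> : D d 0 = 0 by [].
rewrite !add0r mulr0 subr0 mulr1 -exprnP exprS => /(canRL (subrK _)) ->; ring.
Qed.
End Digits.

(** * Bounds for A(u) and B(u) *)

Section Quadratic.
Variables (R : realType) (d : nat).
Hypothesis hd : (2 <= d)%N.
Local Notation a := (alpha R d).
Local Notation b := (beta R d).

Lemma alphaDbeta : a + b = d%:R.
Proof. by rewrite /alpha /beta; field. Qed.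

Lemma alphaMbeta : a * b = -1.
Proof.
have h : Num.sqrt (d%:R ^+ 2 + 4) ^+ 2 = d%:R ^+ 2 + 4 :> R.
  by rewrite sqr_sqrtr // addr_ge0 // sqr_ge0.
by rewrite /alpha /beta; field: h.
Qed.

Lemma alpha_gt2 : 2 < a.
Proof.
have d2 : 2 <= d%:R :> R by rewrite ler_nat.
have : d%:R < Num.sqrt (d%:R ^+ 2 + 4) :> R.
  rewrite -[ltLHS]ger0_norm // -sqrtr_sqr ltr_sqrt; nra.
by rewrite /alpha; lra.
Qed.

Lemma beta_bounds : - 1 / 2 < b < 0.
Proof. by have := alphaMbeta; have := alpha_gt2; nra. Qed.

(** A last digit d is preceded by 0, and d alpha^(n+1) + alpha^n = alpha^(n+2); a smaller last digit
    leaves room because d < alpha. *)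
Lemma digit_eval_alpha_lt u : ostrowski d u ->
  0 <= digit_eval a u < a ^+ size u.
Proof.
have := alphaDbeta; have := alphaMbeta; have := alpha_gt2; move=> a2 ab1 abd.
have ap n : 0 < a ^+ n by apply: exprn_gt0; lra.
have [n] := ubnP (size u); elim: n u => // n IH u.
case/lastP: u => [|u x]; first by rewrite /digit_eval big_ord0 expr0 lexx ltr01.
rewrite size_rcons ltnS ostrowski_rcons // => su /and4P[ou xd ux0 xl].
have := IH _ su ou; rewrite digit_eval_rcons exprS; have := ap (size u).
case: (eqVneq x d) xl ux0 => [-> /= ul|xnd _ _]; last first.
  have : x%:R + 1 <= d%:R :> R by rewrite natr1 ler_nat; lia.
  have : 0 <= x%:R :> R by [].
  have := beta_bounds; nra.
case/lastP: u ul ou su => [|u y]; first by rewrite ltnn.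
rewrite last_rcons => /eqP ->; rewrite ostrowski_rcons // => /and4P[ou _ _ _].
rewrite size_rcons => su D0 _; have := IH _ (ltnW su) ou.
rewrite digit_eval_rcons mul0r addr0 exprS; have := ap (size u).
have : 0 <= d%:R :> R by [].
move: (a ^+ size u) (digit_eval a u) => p e; nra.
Qed.

Lemma digit_eval_alpha_ge u : ostrowski d u -> last 0%N u != 0%N ->
  a ^+ (size u).-1 <= digit_eval a u.
Proof.
case/lastP: u => // u x; rewrite last_rcons ostrowski_rcons //.
rewrite digit_eval_rcons size_rcons /= => /andP[/digit_eval_alpha_lt + _] x0.
have : 1 <= x%:R :> R by rewrite (ler_nat _ 1); lia.
have : 0 < a ^+ size u by apply: exprn_gt0; have := alpha_gt2; lra.
nra.
Qed.

(* The two alternatives are forced by c + beta * (digit_eval of the tail) and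
   the equations d - beta = alpha, alpha * beta = -1. *)
Lemma digit_eval_beta_bounds u :
  all (fun x => (x <= d)%N) u ->
  sorted (fun x y => (y == d) ==> (x == 0)%N) u ->
  if (head 0%N u < d)%N then -1 < digit_eval b u < a - 1
  else a - 1 < digit_eval b u < a.
Proof.
have := alphaDbeta; have := alphaMbeta; have := alpha_gt2; have := beta_bounds.
move=> b0 a2 ab1 abd; have ba : b = d%:R - a by rewrite -abd; ring.
elim: u => [|x u IH]; first by rewrite /digit_eval big_ord0 /= ifT; [lra|lia].
move=> /= /andP[xd au] pu; have {}IH := IH au (path_sorted pu).
rewrite digit_eval_cons.
have xd' : x%:R <= d%:R :> R by rewrite ler_nat.
have x0 : 0 <= x%:R :> R by [].
have [lxd|lxd] := ltnP x d; last first.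
  have {xd lxd}xE : x = d by apply/eqP; rewrite eqn_leq xd.
  move: IH; rewrite ifT; last first.
    case: (u) pu au => [|y v] /=; first lia.
    by rewrite xE => /andP[+ _] /andP[]; case: eqVneq => //=; lia.
  move: (digit_eval b u) => e IH; rewrite xE; nra.
have xd1 : x%:R + 1 <= d%:R :> R by rewrite natr1 ler_nat.
case: ifP IH => [_|hu]; first by move: (digit_eval b u) => e IH; nra.
have -> : x = 0%N.
  case: (u) hu pu au => [|y v] /=; first lia.
  move=> yd /andP[+ _] /andP[yd' _]; have -> : y = d by lia.
  by rewrite eqxx => /eqP.
move: (digit_eval b u) => e IH; nra.
Qed.

Lemma ostrowski_beta_bounds u : ostrowski d u -> -1 < digit_eval b u < a - 1.
Proof.
by move=> /and3P[hu au su]; have := digit_eval_beta_bounds au su; rewrite hu.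
Qed.

(** A nonzero first digit is not followed by d, so B(u) > 1 + beta (alpha - 1) = - beta. A word
    starting with 0 d has -1 < B(u) < -1 - beta, and 1 + beta > - beta because beta > -1/2. *)
Lemma trimmed_beta_bounds u : trimmed d u -> - b < `|digit_eval b u| < a.
Proof.
have := alphaDbeta; have := alphaMbeta; have := alpha_gt2; have := beta_bounds.
move=> b0 a2 ab1 abd [ou lu tu]; have := ostrowski_beta_bounds ou.
case: u ou lu tu => // x u /and3P[hx /andP[xd au] su] lu tu.
have := digit_eval_beta_bounds au (path_sorted su).
rewrite digit_eval_cons; have [x0|x0] := posnP x.
  case: ifP => [hu _|_]; last first.
    rewrite x0; move: (digit_eval b u) => e h _.
    have : b * e < -1 - b by nra.
    have : -1 < b * e by nra.
    by move=> h1 h2; rewrite ltr0_norm; lra.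
  case: (tu u); last by rewrite x0.
  by apply/and3P; split=> //; exact: path_sorted su.
have x1 : 1 <= x%:R :> R by rewrite (ler_nat _ 1).
have -> : (head 0%N u < d)%N.
  case: (u) su au {tu lu} => [|y v] /=; first lia.
  move=> /andP[+ _] /andP[yd _]; case: eqVneq => /=; lia.
move: (digit_eval b u) => e h1 h2.
have : - b < x%:R + b * e by nra.
by move=> h3; rewrite gtr0_norm; lra.
Qed.

(** * Word length and the floor of the logarithm *)

(** [row_geom] is compared with [recurrent_geom] for x, once for each order of the roots; |beta| =
    1/alpha turns the second power into alpha^(-s). *)
Lemma row_size_bounds u (x : int -> int) (s : int) (N : R) :
  trimmed d u -> recurrent d x -> 0 < N ->
  (x 1)%:~R - b * (x 0)%:~R = N -> `|(x 1)%:~R - a * (x 0)%:~R| = N ->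
  (forall n, Defs.row d u n = x (n + s)) ->
  digit_eval a u = a ^ s * N /\ `|digit_eval b u| = a ^ (- s) * N.
Proof.
move=> tu rx N0 xb xa xu.
have a0 : 0 < a by have := alpha_gt2; lra.
have aN0 : a != 0 by rewrite gt_eqF.
have bN0 : b != 0 by have := beta_bounds; lra.
have bE : `|b| = a^-1.
  have : b = - a^-1 by apply: (mulfI aN0); rewrite mulrN divff // alphaMbeta.
  by move=> ->; rewrite normrN gtr0_norm // invr_gt0.
have rE (c e : R) : c + e = d%:R -> c * e = -1 -> c != 0 ->
    digit_eval c u = c ^ s * ((x 1)%:~R - e * (x 0)%:~R).
  move=> ce1 ce2 c0; apply: (mulfI c0); rewrite -(row_geom u ce1 ce2) !xu.
  have := recurrent_geom 0 (1 + s) ce1 ce2 rx.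
  have -> : 0 + (1 + s) + 1 = 2 + s by lia.
  by rewrite !add0r => ->; rewrite expfzDr // expr1z mulrA.
split; first by rewrite (rE _ _ alphaDbeta alphaMbeta aN0) xb.
have -> : digit_eval b u = b ^ s * ((x 1)%:~R - a * (x 0)%:~R).
  by apply: rE; rewrite // 1?[b + a]addrC 1?[b * a]mulrC ?alphaDbeta ?alphaMbeta.
rewrite normrM; have -> : `|b ^ s| = `|b| ^ s.
  by case: (s) => n; rewrite /exprz ?normfV normrX.
by rewrite xa -exprz_inv bE.
Qed.

Lemma in_block_floor u (x : int -> int) (s : int) (N : R) k :
  trimmed d u -> recurrent d x -> 0 < N ->
  (x 1)%:~R - b * (x 0)%:~R = N -> `|(x 1)%:~R - a * (x 0)%:~R| = N ->
  (forall n, Defs.row d u n = x (n + s)) ->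
  in_block k u <-> Num.floor (logb a N) + 1 = k%:Z.
Proof.
move=> tu rx N0 xb xa xu; have [ou lu _] := tu.
have [eA eB] := row_size_bounds tu rx N0 xb xa xu.
have a2 := alpha_gt2; have a0 : 0 < a by lra.
have /andP[_ A1] := digit_eval_alpha_lt ou; have A2 := digit_eval_alpha_ge ou lu.
have /andP[B1 B2] := trimmed_beta_bounds tu.
have bE : - b = a^-1.
  by apply: (mulfI (lt0r_neq0 a0)); rewrite mulrN alphaMbeta opprK divff // gt_eqF.
have l0 : 0 < ln a by apply: ln_gt0; lra.
have lnz (z : int) : ln (a ^ z) = z%:~R * ln a.
  by rewrite -powR_intmul ?ltW // ln_powR.
have lnN : ln N = logb a N * ln a by rewrite /logb divfK // gt_eqF.
have lnM (z : int) : ln (a ^ z * N) = (z%:~R + logb a N) * ln a.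
  by rewrite lnM ?posrE ?exprz_gt0 // lnz lnN mulrDl.
have le_log (z y : int) : a ^ z <= a ^ y * N -> z%:~R <= y%:~R + logb a N.
  by rewrite -ler_ln ?posrE ?mulr_gt0 ?exprz_gt0 // lnz lnM ler_pM2r.
have lt_log (z y : int) : a ^ z < a ^ y * N -> z%:~R < y%:~R + logb a N.
  by rewrite -ltr_ln ?posrE ?mulr_gt0 ?exprz_gt0 // lnz lnM ltr_pM2r.
have gt_log (z y : int) : a ^ y * N < a ^ z -> y%:~R + logb a N < z%:~R.
  by rewrite -ltr_ln ?posrE ?mulr_gt0 ?exprz_gt0 // lnz lnM ltr_pM2r.
move: A1 A2 B1 B2; rewrite eA eB bE.
move=> /(gt_log (size u)) + /(le_log (size u).-1) + /(lt_log (-1)) + /(gt_log 1).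
have su : (0 < size u)%N by case: (u) lu.
move: (logb a N) => t.
have -> : (size u).-1%:Z%:~R = (size u)%:Z%:~R - 1 :> R.
  by rewrite -[1]/(1%:~R) -rmorphB /=; congr (_%:~R); lia.
rewrite !rmorphN /= => h1 h2 h3 h4.
(* Eliminating t between the bounds for A(u) and B(u) leaves L - 2 < 2 s < L + 1, where L is the
   length of u. *)
have s1 : (size u)%:Z - 1 <= 2 * s.
  suff : (size u)%:Z - 2 < 2 * s by lia.
  by rewrite -(ltr_int R) rmorphB rmorphM /=; lra.
have s2 : 2 * s <= (size u)%:Z.
  suff : 2 * s < (size u)%:Z + 1 by lia.
  by rewrite -(ltr_int R) rmorphD rmorphM /=; lra.
have -> : Num.floor t = (size u)%:Z - s - 1.
  by apply: floor_def; rewrite !rmorphB rmorphD !rmorphB /=; lra.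
(* Here s is L/2 rounded down, so L - s is L/2 rounded up. *)
rewrite /in_block; split; lia.
Qed.

(** * The correspondence between parameters and rows *)

Lemma trimmed_row_exists (x : int -> int) (N : R) :
  recurrent d x -> 0 < N ->
  (x 1)%:~R - b * (x 0)%:~R = N -> `|(x 1)%:~R - a * (x 0)%:~R| = N ->
  exists u s, trimmed d u /\ forall n, Defs.row d u n = x (n + s).
Proof.
move=> rx N0 xb xa.
have abd := alphaDbeta; have ab1 := alphaMbeta; have a2 := alpha_gt2.
have b0 := beta_bounds.
have bad : b + a = d%:R by rewrite addrC.
have ba1 : b * a = -1 by rewrite mulrC.
(* This n gives N alpha < n <= 2^n <= alpha^n, which makes |x_(n+1) - alpha x_n| = N / alpha^n
   smaller than 1/alpha = - beta. *)
pose n := (Num.trunc (N * a)).+1; pose p := a ^+ n.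
have Np : N * a < p.
  apply: (lt_le_trans (truncnS_gt _)); rewrite -/n /p.
  apply: (@le_trans _ _ (2 ^+ n)); last by apply: lerXn2r; rewrite ?nnegrE; lra.
  by rewrite -natrX ler_nat ltnW // ltn_expl.
have p1 : 1 < p by rewrite /p exprn_egt1 //; lra.
have p0 : 0 < p by lra.
have := recurrent_geom 0 n%:Z abd ab1 rx; have := recurrent_geom 0 n%:Z bad ba1 rx.
rewrite !add0r -!exprnP xb -/p; set y := (x 1)%:~R - _ in xa *.
have bp : p * b ^+ n = (-1) ^+ n by rewrite /p -exprMn ab1.
have : `|p * (b ^+ n * y)| = N.
  by rewrite mulrA bp normrM xa normrX normrN1 expr1n mul1r.
rewrite normrM gtr0_norm; last lra.
move=> + Q P; rewrite -Q => nQ.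
have Qb : `|(x (n%:Z + 1))%:~R - a * (x n%:Z)%:~R| < - b.
  rewrite -(ltr_pM2l p0) nQ; have NE : N = - b * (N * a).
    by rewrite mulrCA mulNr ba1 opprK mulr1.
  by rewrite NE [ltRHS]mulrC ltr_pM2l //; lra.
have : 0 < x n%:Z.
  have ab : 0 < a - b by lra.
  rewrite -(ltr0z R) -(pmulr_rgt0 _ ab).
  have -> : (a - b) * (x n%:Z)%:~R = p * N - ((x (n%:Z + 1))%:~R - a * (x n%:Z)%:~R).
    by rewrite -P; ring.
  rewrite subr_gt0; apply: le_lt_trans (ler_norm _) _.
  have q0 : 0 < `|(x (n%:Z + 1))%:~R - a * (x n%:Z)%:~R|.
    by rewrite -(pmulr_rgt0 _ p0) nQ.
  by rewrite (lt_trans _ (_ : N < _)) ?ltr_pMl // -nQ ltr_pMl.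
move=> /(ostrowski_pos_exists hd)[v [ov lv vE]].
have r1 : Defs.row d v 1 = x n%:Z by rewrite -vE.
(* Both sides are within 1 of each other, hence equal: each differs from
   alpha * x n by an amount in the interval ]-1 - beta, - beta[. *)
have r2 : Defs.row d v 2 = x (n%:Z + 1).
  have := row_geom v bad ba1; have := ostrowski_beta_bounds ov; rewrite r1.
  move: Qb; rewrite ltr_norml => Qb eb re.
  have h1 : Defs.row d v 2 < x (n%:Z + 1) + 1.
    by rewrite -(ltr_int R) rmorphD /=; nra.
  have h2 : x (n%:Z + 1) < Defs.row d v 2 + 1.
    by rewrite -(ltr_int R) rmorphD /=; nra.
  lia.
have vx : Defs.row d v =1 (fun m => x (m + (n%:Z - 1))).
  apply: (@recurrent_unique d _ _ 1); first exact: row_rec.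
  - exact: recurrent_shift.
  - by rewrite r1; congr x; lia.
  - by rewrite r2; congr x; lia.
(* Removing i leading zeros from v shifts its row by - i. *)
have [u [i [tu uE]]] := trimmed_of_ostrowski ov lv.
exists u, (n%:Z - 1 - i%:Z); split=> // m.
have := vx (m - i%:Z); rewrite uE row_shiftn subrK => ->; congr x; lia.
Qed.

(** Parameters, sequences and N are kept abstract so that the same bijection serves multiples of D
    indexed by integers and multiples of E indexed by J. *)
Lemma rows_card (T : Type) (P : set T) (X : T -> int -> int) (N : T -> R) w k :
  trimmed_listing d w ->
  (forall j, P j -> [/\ recurrent d (X j), 0 < N j,
     (X j 1)%:~R - b * (X j 0)%:~R = N j &
     `|(X j 1)%:~R - a * (X j 0)%:~R| = N j]) ->
  (forall i j, P i -> P j -> N i = N j -> i = j) ->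
  [set m | [/\ (0 < m)%N, in_block k (w m) & exists j s, P j /\
     forall n, Defs.row d (w m) n = X j (n + s)]] #=
  [set j | P j /\ Num.floor (logb a (N j)) + 1 = k%:Z].
Proof.
move=> [tw sw lw] PX Ninj.
have /choice[g gP] j : exists m, P j -> (0 < m)%N /\
    exists s, forall n, Defs.row d (w m) n = X j (n + s).
  have [Pj|nPj] := pselect (P j); last by exists 0%N.
  have [rX N0 Xb Xa] := PX _ Pj.
  have [u [s [tu us]]] := trimmed_row_exists rX N0 Xb Xa.
  by have [m m0 mu] := sw _ tu; exists m => _; split=> //; exists s; rewrite mu.
have winj m n : (0 < m)%N -> (0 < n)%N -> w m = w n -> m = n.
  move=> m0 n0 e; case: (ltngtP m n) => // mn.
    by have := lw _ _ m0 mn; rewrite e ltxx.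
  by have := lw _ _ n0 mn; rewrite e ltxx.
rewrite card_eq_sym; apply/card_set_bijP; exists g; split.
- move=> j [Pj fj] /=; have [g0 [s gs]] := gP _ Pj.
  have [rX N0 Xb Xa] := PX _ Pj; split=> //; last by exists j, s.
  by apply/(in_block_floor k (tw _ g0) rX N0 Xb Xa gs).
- move=> i j; rewrite !inE => -[Pi _] [Pj _] gij.
  have [g0 [s gs]] := gP _ Pi; have [_ [t gt]] := gP _ Pj; rewrite -gij in gt.
  have [rX N0 Xb Xa] := PX _ Pi; have [rX' N0' Xb' Xa'] := PX _ Pj.
  have [eA eB] := row_size_bounds (tw _ g0) rX N0 Xb Xa gs.
  have [eA' eB'] := row_size_bounds (tw _ g0) rX' N0' Xb' Xa' gt.
  have a0 : a != 0 by have := alpha_gt2; lra.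
  (* The product A(u) |B(u)| = N^2 is free of the shift, so the row determines N and hence the
     parameter. *)
  have sq (r : int) M : (a ^ r * M) * (a ^ (- r) * M) = M ^+ 2.
    by rewrite mulrACA -expfzDr // subrr expr0z mul1r.
  apply: Ninj => //; apply/eqP; rewrite -(eqrXn2 (n := 2)) ?ltW //.
  by rewrite -(sq s) -(sq t) -eA -eB eA' eB'.
- move=> m [m0 bm [j [s [Pj js]]]].
  have [rX N0 Xb Xa] := PX _ Pj; exists j.
    by split=> //; apply/(in_block_floor k (tw _ m0) rX N0 Xb Xa js).
  have [g0 [t gt]] := gP _ Pj; apply: winj => //.
  exact: (trimmed_shift_unique hd (tw _ g0) (tw _ m0) gt js).
Qed.
End Quadratic.

(** * Finiteness of blocks and integrality of the multiples of E *)

(** Values increase strictly along the listing, so word m + 1 has value at least m, while words of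
    block k have values below D_(2k+1). *)
Lemma finite_block d w k : (2 <= d)%N -> trimmed_listing d w ->
  finite_set [set m | (0 < m)%N /\ in_block k (w m)].
Proof.
move=> hd [tw _ lw].
have ge m : m%:Z <= value d (w m.+1).
  elim: m => [|m IH]; last by have := lw m.+1 m.+2 isT (ltnSn _); lia.
  by have [ou _ _] := tw 1%N isT; have /andP[] := value_bounds hd ou.
apply: (@sub_finite_set _ _ `I_(`|D d (2 * k).+1%:Z|%N.+1)); last exact: finite_II.
move=> [|m] [// m0 bm] /=; have [ou _ _] := tw _ m0.
have /andP[_ h] := value_bounds hd ou.
have : D d (size (w m.+1)).+1%:Z <= D d (2 * k).+1%:Z.
  by apply: D_le => //; move: bm; rewrite /in_block; lia.
have := ge m; lia.
Qed.

(** Halving the initial values 2 and d gives an integer solution of the same recurrence. *)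
Lemma E_even d n : ~~ odd d -> exists z, E d n = 2 * z.
Proof.
move=> od; exists (two_sided d 1 (d./2)%:Z n); move: n.
apply: (@recurrent_unique d _ _ 0) => // [n|n|].
- exact: two_sided_rec.
- by rewrite two_sided_rec; ring.
- by rewrite add0r /E !two_sided1; lia.
Qed.

(** Taking [numq] turns the rational multiples of E into the integer sequences that [rows_card]
    expects. *)
Lemma J_mul_E d q n : J d q -> q * (E d n)%:~R = (numq (q * (E d n)%:~R))%:~R.
Proof.
move=> [i i0 ->]; have [z ->] : exists z : int,
    (if odd d then i%:R else i%:R / 2) * (E d n)%:~R = z%:~R :> rat; last first.
  by rewrite numq_int.
case: ifP => [_|/negbT /(E_even n)[z ->]].
  by exists (i%:Z * E d n); rewrite rmorphM.
by exists (i%:Z * z); rewrite !rmorphM /=; field.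
Qed.

Theorem theorem4 (R : realType) (d : nat) (hd : (2 <= d)%N)
    (w : nat -> seq nat) (hw : trimmed_listing d w)
    (k : nat) (hk : (1 <= k)%N) :
  let deedees := [set m : nat | [/\ (0 < m)%N, in_block k (w m) & deedee d (w m)]] in
  let edees := [set m : nat | [/\ (0 < m)%N, in_block k (w m) & edee d (w m)]] in
  [/\ finite_set deedees,
      deedees #= [set n : nat | (0 < n)%N /\
        Num.floor (logb (alpha R d) n%:R) + 1 = k%:Z],
      finite_set edees &
      edees #= [set n : rat | J d n /\
        Num.floor (logb (alpha R d) (ratr n * (alpha R d - beta R d))) + 1 = k%:Z]].

Proof.
move=> deedees edees; split.
- by apply: sub_finite_set (finite_block k hd hw) => m [].
- apply: (@rows_card R d hd nat [set j | (0 < j)%N] (fun j n => j%:Z * D d n)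
    (fun j => j%:R) w k hw) => [j j0|i j _ _ /eqP]; last first.
    by rewrite eqr_nat => /eqP.
  rewrite /D two_sided0 two_sided1 !mulr0 !mulr1 !subr0 -!pmulrn normr_nat.
  split=> // [n|]; last by rewrite ltr0n.
  by rewrite two_sided_rec; ring.
- by apply: sub_finite_set (finite_block k hd hw) => m [].
- have -> : edees = [set m | [/\ (0 < m)%N, in_block k (w m) & exists j s,
      J d j /\ forall n, Defs.row d (w m) n = numq (j * (E d (n + s))%:~R)]].
    apply/seteqP; split=> m [m0 bm [j [s [Jj js]]]]; split=> //; exists j, s;
      split=> // n; have {}js := js n.
      by apply: (@intr_inj rat); rewrite js; exact: J_mul_E.
    by rewrite js; symmetry; exact: J_mul_E.
  have ab : 0 < alpha R d - beta R d.
    by have := alpha_gt2 R hd; have := beta_bounds R hd; lra.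
  apply: (@rows_card R d hd rat (J d) (fun q n => numq (q * (E d n)%:~R))
    (fun q => ratr q * (alpha R d - beta R d)) w k hw); last first.
    move=> i j _ _ /(mulIf (lt0r_neq0 ab)); exact: fmorph_inj.
  move=> q Jq; have q0 : 0 < ratr q :> R.
    rewrite ltr0q; case: Jq => i i0 ->; case: ifP => _; rewrite ?divr_gt0 ?ltr0n //.
  have XE n : (numq (q * (E d n)%:~R))%:~R = ratr q * (E d n)%:~R :> R.
    by rewrite -[LHS]ratr_int -J_mul_E // rmorphM /= ratr_int.
  (* With d = alpha + beta, the initial values 2 q and d q give q (d - 2 beta) = q (alpha - beta)
     and q (d - 2 alpha) = - q (alpha - beta). *)
  rewrite !XE /E two_sided0 two_sided1 -!pmulrn -(alphaDbeta R d).
  split.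
  + move=> n; apply/eqP; rewrite -(eqr_int rat) rmorphD rmorphM /= -!J_mul_E //.
    by rewrite /E two_sided_rec rmorphD rmorphM /=; apply/eqP; ring.
  + exact: mulr_gt0.
  + ring.
  + rewrite [X in `|X|](_ : _ = - (ratr q * (alpha R d - beta R d))); last ring.
    by rewrite normrN gtr0_norm // mulr_gt0.
Qed.
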